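(* Let $\alpha,a\in\mathbb{R}$. For every integer $N\ge 0$ and all $x\in\mathbb{R}$, $$Q_{N}^{(\alpha,-a)}(x)=\sum_{\nu=0}^N\binom{N}{\nu}\,\nu!\;Q^{(\alpha,1)}_{N-\nu}(x)\sum_{n=0}^{[\nu/2]}\binom{-a-1}{n}x^{2n}\,C^{(n+a+1)}_{\nu-2n}(-x),$$ where $[\nu/2]$ denotes the integer part of $\nu/2$ and $C_l^{(\lambda)}$ are the Gegenbauer polynomials.
   Context: Throughout $x$ is a real variable, $\alpha,a$ are real parameters, $\sigma(x)=1+x^2$, and $\cot^{-1}:\mathbb{R}\to(0,\pi)$ is the smooth branch, so that $\frac{d}{dx}\cot^{-1}x=-1/\sigma(x)$. For integers $l\ge 0$ put $w_l(x)=\sigma(x)^{-(l+a+1)}e^{-\alpha\cot^{-1}x}=\sigma(x)^{-l}w_0(x)$. Define $P_l^{(a,\alpha)}(x)=\frac{1}{w_l(x)}\frac{d^l}{dx^l}[w_l(x)\sigma(x)^l]=\frac{\sigma(x)^l}{w_0(x)}\frac{d^l w_0(x)}{dx^l}$. The complementary (Romanovski) polynomials $Q_\nu^{(\alpha,-a)}$, with $Q_0^{(\alpha,-a)}\equiv 1$, are defined by the Rodrigues representation $P_l^{(a,\alpha)}(x)=\frac{1}{w_l(x)}\frac{d^{l-\nu}}{dx^{l-\nu}}[\sigma(x)^{l-\nu}w_l(x)Q_\nu^{(\alpha,-a)}(x)]$ for all integers $0\le\nu\le l$ (the case $l=\nu$ reads $Q_\nu^{(\alpha,-a)}=P_\nu^{(a,\alpha)}$).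 The second upper index is minus the parameter $a$ of the weight; thus $Q^{(\alpha,1)}_{\nu}$ has $a$ replaced by $-1$. The Gegenbauer polynomials are defined, for every real $\lambda$, by $(1-2xy+y^2)^{-\lambda}=\sum_{l=0}^{\infty}C_l^{(\lambda)}(x)y^l$ (power series in $y$ near $0$). $\binom{c}{n}=c(c-1)\cdots(c-n+1)/n!$ is the generalized binomial coefficient. *)

(* Defs.v *)
From Stdlib Require Import Reals Arith Lra Lia.
From Coquelicot Require Import Coquelicot.
Open Scope R_scope.

Definition sigma (x : R) : R := 1 + x ^ 2.

(* The smooth branch of the inverse cotangent, with values in (0, PI). *)
Definition arccot (x : R) : R := PI / 2 - atan x.

(* [Rpower] is the genuine real power here, since [sigma x > 0]. *)
Definition weight (a alpha : R) (l : nat) (x : R) : R :=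
  Rpower (sigma x) (- (INR l + a + 1)) * exp (- alpha * arccot x).

(* [romanovski a alpha l] is P_l^(a,alpha). *)
Definition romanovski (a alpha : R) (l : nat) (x : R) : R :=
  / weight a alpha l x *
  Derive_n (fun t => weight a alpha l t * sigma t ^ l) l x.

(* [Q alpha b nu] is Q_nu^(alpha,b); the second index is minus the parameter
   [a] of the weight.  The case [nu = l] of the Rodrigues representation gives
   [Q alpha (- a) nu = romanovski a alpha nu], so such a [Q] is unique, and
   smooth in [x]; it exists by [complementary_exists]. *)
Definition is_complementary (Q : R -> R -> nat -> R -> R) : Prop :=
  forall alpha a : R,
    (forall x : R, Q alpha (- a) 0%nat x = 1) /\
    (forall (l nu : nat) (x : R), (nu <= l)%nat ->
       romanovski a alpha l x =
       / weight a alpha l x *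
       Derive_n (fun t => sigma t ^ (l - nu) * weight a alpha l t *
                          Q alpha (- a) nu t) (l - nu) x).

(* [C lambda l x] is C_l^(lambda)(x).  For [y] near 0 the base of the real
   power is positive.  Such a [C] is unique, and exists by
   [gegenbauer_exists]. *)
Definition is_gegenbauer (C : R -> nat -> R -> R) : Prop :=
  forall lambda x : R,
    locally 0 (fun y : R =>
      is_pseries (fun l => C lambda l x) y
                 (Rpower (1 - 2 * x * y + y ^ 2) (- lambda))).

(* c (c - 1) ... (c - n + 1) *)
Fixpoint falling (c : R) (n : nat) : R :=
  match n with
  | O => 1
  | S m => falling c m * (c - INR m)
  end.

Definition gbinom (c : R) (n : nat) : R := falling c n / INR (fact n).

Lemma arccot_range (x : R) : 0 < arccot x < PI.
Proof. unfold arccot; destruct (atan_bound x); lra. Qed.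

Lemma cot_arccot (x : R) : cos (arccot x) / sin (arccot x) = x.
Proof.
unfold arccot. rewrite cos_shift, sin_shift. apply tan_atan.
Qed.

Lemma is_derive_arccot (x : R) : is_derive arccot x (- / sigma x).
Proof.
unfold arccot, sigma.
evar_last; [apply is_derive_Reals, derivable_pt_lim_minus|].
- apply derivable_pt_lim_const.
- apply derivable_pt_lim_atan.
- unfold Rsqr. field. nra.
Qed.

Lemma sigma_pos (x : R) : 0 < sigma x.
Proof. unfold sigma; nra. Qed.

Lemma weight_pos (a alpha : R) (l : nat) (x : R) : 0 < weight a alpha l x.
Proof. apply Rmult_lt_0_compat; apply exp_pos. Qed.

Lemma weight_sigma (a alpha : R) (l : nat) (x : R) :
  weight a alpha l x * sigma x ^ l = weight a alpha 0 x.
Proof.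
unfold weight. rewrite <- (Rpower_pow l (sigma x) (sigma_pos x)).
rewrite Rmult_assoc, (Rmult_comm (exp _)), <- Rmult_assoc, <- Rpower_plus.
f_equal. f_equal. simpl. ring.
Qed.

Lemma complementary_exists : exists Q, is_complementary Q.
Proof.
exists (fun alpha b nu => romanovski (- b) alpha nu).
intros alpha a. rewrite Ropp_involutive. split.
- intros x. unfold romanovski. simpl. field.
  apply Rgt_not_eq, weight_pos.
- intros l nu x Hle. unfold romanovski at 1. f_equal.
  rewrite (Derive_n_ext _ _ l x (weight_sigma a alpha l)).
  assert (E : forall t, sigma t ^ (l - nu) * weight a alpha l t *
            romanovski a alpha nu t = Derive_n (weight a alpha 0) nu t).
  { intros t. unfold romanovski.
    rewrite (Derive_n_ext _ _ nu t (weight_sigma a alpha nu)).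
    assert (Hs := sigma_pos t).
    assert (E : sigma t ^ (l - nu) * weight a alpha l t = weight a alpha nu t).
    { apply (Rmult_eq_reg_r (sigma t ^ nu)); [|apply pow_nonzero; lra].
      rewrite weight_sigma, <- (weight_sigma a alpha l).
      replace (sigma t ^ l) with (sigma t ^ (l - nu) * sigma t ^ nu)
        by (rewrite <- pow_add; f_equal; lia).
      ring. }
    rewrite E. field. apply Rgt_not_eq, weight_pos. }
  rewrite (Derive_n_ext _ _ (l - nu) x E), Derive_n_comp.
  f_equal. lia.
Qed.

(* (C_n, C_{n+1}), from the three-term recurrence *)
Fixpoint geg_pair (lambda x : R) (n : nat) : R * R :=
  match n with
  | O => (1, 2 * lambda * x)
  | S m => let (u, v) := geg_pair lambda x m in
           (v, (2 * x * (INR m + 1 + lambda) * v - (INR m + 2 * lambda) * u)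
               / (INR m + 2))
  end.

Definition geg (lambda : R) (n : nat) (x : R) : R := fst (geg_pair lambda x n).

Lemma geg_rec (lambda x : R) (n : nat) :
  (INR n + 2) * geg lambda (S (S n)) x =
  2 * x * (INR n + 1 + lambda) * geg lambda (S n) x
  - (INR n + 2 * lambda) * geg lambda n x.
Proof.
unfold geg; simpl. destruct (geg_pair lambda x n) as [u v]; simpl.
field. assert (H := pos_INR n); lra.
Qed.

Definition geg_bound (lambda x : R) : R :=
  2 * Rabs x * (1 + Rabs lambda) + 1 + 2 * Rabs lambda.

Lemma geg_bound_ge1 (lambda x : R) : 1 <= geg_bound lambda x.
Proof.
unfold geg_bound. assert (H := Rabs_pos x); assert (H' := Rabs_pos lambda). nra.
Qed.

Lemma geg_le (lambda x : R) (n : nat) :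
  Rabs (geg lambda n x) <= geg_bound lambda x ^ n.
Proof.
assert (HK := geg_bound_ge1 lambda x).
assert (Hx := Rabs_pos x). assert (Hl := Rabs_pos lambda).
enough (H : Rabs (geg lambda n x) <= geg_bound lambda x ^ n /\
            Rabs (geg lambda (S n) x) <= geg_bound lambda x ^ S n)
  by exact (proj1 H).
induction n as [|n [IH1 IH2]].
- unfold geg; simpl. split; [rewrite Rabs_R1; lra|].
  rewrite !Rabs_mult, (Rabs_right 2) by lra. unfold geg_bound. nra.
- split; [exact IH2|].
  assert (Hn := pos_INR n).
  apply (Rmult_le_reg_l (INR n + 2)); [lra|].
  rewrite <- (Rabs_right (INR n + 2)) at 1 by lra.
  rewrite <- Rabs_mult, geg_rec.
  set (K := geg_bound lambda x) in *.
  set (u := geg lambda n x) in *. set (v := geg lambda (S n) x) in *.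
  assert (HKn : 1 <= K ^ n) by (apply pow_R1_Rle; lra).
  assert (Hu : Rabs u <= K ^ S n) by (simpl; nra).
  assert (B1 : Rabs (INR n + 1 + lambda) <= (INR n + 2) * (1 + Rabs lambda)).
  { eapply Rle_trans; [apply Rabs_triang|].
    rewrite (Rabs_right (INR n + 1)) by lra. nra. }
  assert (B2 : Rabs (INR n + 2 * lambda) <= (INR n + 2) * (1 + 2 * Rabs lambda)).
  { eapply Rle_trans; [apply Rabs_triang|].
    rewrite (Rabs_right (INR n)), Rabs_mult, (Rabs_right 2) by lra. nra. }
  unfold Rminus at 1. eapply Rle_trans; [apply Rabs_triang|].
  rewrite Rabs_Ropp, !Rabs_mult, (Rabs_right 2) by lra.
  assert (T1 : 2 * Rabs x * Rabs (INR n + 1 + lambda) * Rabs v <=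
               2 * Rabs x * ((INR n + 2) * (1 + Rabs lambda)) * K ^ S n).
  { apply Rmult_le_compat; [|apply Rabs_pos| |exact IH2].
    - apply Rmult_le_pos; [lra|apply Rabs_pos].
    - apply Rmult_le_compat_l; [lra|exact B1]. }
  assert (T2 : Rabs (INR n + 2 * lambda) * Rabs u <=
               (INR n + 2) * (1 + 2 * Rabs lambda) * K ^ S n).
  { apply Rmult_le_compat; auto using Rabs_pos. }
  replace (K ^ S (S n)) with (K * K ^ S n) by reflexivity.
  replace ((INR n + 2) * (K * K ^ S n)) with
    (2 * Rabs x * ((INR n + 2) * (1 + Rabs lambda)) * K ^ S n +
     (INR n + 2) * (1 + 2 * Rabs lambda) * K ^ S n)
    by (unfold K at 3, geg_bound; ring).
  lra.
Qed.

Lemma geg_CV_radius (lambda x y : R) :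
  Rabs y < / geg_bound lambda x ->
  Rbar_lt (Rabs y) (CV_radius (fun n => geg lambda n x)).
Proof.
intros Hy. assert (HK := geg_bound_ge1 lambda x).
apply Rbar_lt_le_trans with (/ geg_bound lambda x); [exact Hy|].
apply (proj1 (CV_radius_bounded (fun n => geg lambda n x))).
exists 1. intros n. rewrite Rabs_mult, <- RPow_abs.
rewrite (Rabs_right (/ _)) by (apply Rle_ge, Rlt_le, Rinv_0_lt_compat; lra).
rewrite pow_inv.
apply (Rmult_le_reg_r (geg_bound lambda x ^ n)); [apply pow_lt; lra|].
rewrite Rmult_assoc, Rinv_l by (apply pow_nonzero; lra).
assert (H := geg_le lambda x n). lra.
Qed.

(* The generating function solves (1 - 2xy + y^2) f' = 2 lambda (x - y) f. *)
Lemma geg_ode (lambda x y : R) :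
  Rabs y < / geg_bound lambda x ->
  (1 - 2 * x * y + y ^ 2) * PSeries (PS_derive (fun n => geg lambda n x)) y =
  2 * lambda * (x - y) * PSeries (fun n => geg lambda n x) y.
Proof.
intros Hy. assert (HR := geg_CV_radius lambda x y Hy).
set (c := fun n => geg lambda n x) in *.
assert (Ec : ex_pseries c y) by (apply CV_radius_inside; exact HR).
assert (Ed : ex_pseries (PS_derive c) y) by (apply ex_pseries_derive; exact HR).
assert (E : forall n, PS_plus (PS_derive c) (PS_incr_1 (PS_incr_1 (PS_derive c))) n =
  PS_plus (PS_scal (2 * x) (PS_incr_1 (PS_derive c)))
    (PS_plus (PS_scal (2 * lambda * x) c)
             (PS_scal (- (2 * lambda)) (PS_incr_1 c))) n).
{ intros n.
  unfold PS_plus, PS_scal, PS_incr_1, PS_derive, plus, scal; simpl; unfold mult; simpl.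
  destruct n as [|[|n]]; unfold zero; simpl.
  - unfold c, geg; simpl. ring.
  - assert (H := geg_rec lambda x 0). simpl in H.
    change (geg lambda 2 x) with (c 2%nat) in H.
    change (geg lambda 1 x) with (c 1%nat) in H.
    change (geg lambda 0 x) with (c 0%nat) in H. lra.
  - assert (H := geg_rec lambda x (S n)). rewrite S_INR in H.
    change (geg lambda (S (S (S n))) x) with (c (S (S (S n)))) in H.
    change (geg lambda (S (S n)) x) with (c (S (S n))) in H.
    change (geg lambda (S n) x) with (c (S n)) in H.
    change (match n with 0%nat => 1 | S _ => INR n + 1 end) with (INR (S n)).
    rewrite S_INR. lra. }
apply (PSeries_ext _ _ y) in E.
rewrite !PSeries_plus, !PSeries_scal, !PSeries_incr_1 in E;
  auto using ex_pseries_incr_1, ex_pseries_plus, ex_pseries_scal, Rmult_comm.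
nra.
Qed.

Lemma geg_base_pos (lambda x y : R) :
  Rabs y < / geg_bound lambda x -> 0 < 1 - 2 * x * y + y ^ 2.
Proof.
intros Hy. assert (HK := geg_bound_ge1 lambda x).
apply (Rmult_lt_compat_l (geg_bound lambda x)) in Hy; [|lra].
rewrite Rinv_r in Hy by lra. unfold geg_bound in Hy.
assert (Hx := Rabs_pos x). assert (Hl := Rabs_pos lambda).
assert (Hy0 := Rabs_pos y).
assert (Hxy : x * y <= Rabs x * Rabs y) by (rewrite <- Rabs_mult; apply Rle_abs).
assert (0 <= Rabs x * Rabs lambda * Rabs y) by (repeat apply Rmult_le_pos; auto).
assert (0 <= Rabs lambda * Rabs y) by (apply Rmult_le_pos; auto).
nra.
Qed.

Lemma geg_generating (lambda x y : R) :
  Rabs y < / geg_bound lambda x ->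
  is_pseries (fun n => geg lambda n x) y
             (Rpower (1 - 2 * x * y + y ^ 2) (- lambda)).
Proof.
intros Hy. set (f := PSeries (fun n => geg lambda n x)).
set (h := fun t => f t * Rpower (1 - 2 * x * t + t ^ 2) lambda).
assert (Hh : forall t, Rabs t < / geg_bound lambda x -> is_derive h t 0).
{ intros t Ht. assert (Hb := geg_base_pos lambda x t Ht).
  assert (HO := geg_ode lambda x t Ht).
  assert (Hf := is_derive_PSeries _ _ (geg_CV_radius lambda x t Ht)).
  fold f in Hf, HO. set (f' := PSeries (PS_derive _) t) in *.
  assert (Hg : is_derive (fun s => Rpower (1 - 2 * x * s + s ^ 2) lambda) t
    (lambda * ((2 * t - 2 * x) / (1 - 2 * x * t + t ^ 2)) *
     Rpower (1 - 2 * x * t + t ^ 2) lambda)).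
  { unfold Rpower. auto_derive; [simpl in Hb; lra|].
    simpl. replace (1 - 2 * x * t + t * (t * 1)) with (1 + - (2 * x * t) + t * (t * 1)) by ring.
    field. simpl in Hb. lra. }
  unfold h. evar_last; [apply (is_derive_mult f _ t _ _ Hf Hg Rmult_comm)|].
  unfold plus, mult; simpl.
  set (r := Rpower _ lambda). set (b := 1 - 2 * x * t + t * (t * 1)).
  simpl in HO, Hb. fold b in HO, Hb.
  replace (_ + _) with ((b * f' - 2 * lambda * (x - t) * f t) * (r / b))
    by (field; lra).
  rewrite HO. ring. }
assert (Hin : forall t, Rmin 0 y <= t <= Rmax 0 y -> Rabs t < / geg_bound lambda x).
{ intros t Ht. apply Rle_lt_trans with (2 := Hy).
  revert Ht. unfold Rmin, Rmax. destruct (Rle_dec 0 y); split_Rabs; lra. }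
destruct (MVT_gen h 0 y (fun _ => 0)) as [s [_ Hs]].
- intros t Ht. apply Hh, Hin. lra.
- intros t Ht. apply derivable_continuous_pt. exists 0.
  apply is_derive_Reals, Hh, Hin, Ht.
- assert (H0 : h 0 = 1).
  { unfold h, f. rewrite PSeries_0. unfold geg; simpl.
    unfold Rpower. replace (1 - 2 * x * 0 + 0 * (0 * 1)) with 1 by ring.
    rewrite ln_1, Rmult_0_r, exp_0. ring. }
  assert (Hfy : f y = Rpower (1 - 2 * x * y + y ^ 2) (- lambda)).
  { rewrite Rpower_Ropp.
    assert (Hr : 0 < Rpower (1 - 2 * x * y + y ^ 2) lambda) by apply exp_pos.
    apply (Rmult_eq_reg_r (Rpower (1 - 2 * x * y + y ^ 2) lambda)); [|lra].
    rewrite Rinv_l by lra. change (h y = 1). lra. }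
  rewrite <- Hfy. apply PSeries_correct, CV_radius_inside, geg_CV_radius, Hy.
Qed.

Lemma gegenbauer_exists : exists C, is_gegenbauer C.
Proof.
exists geg. intros lambda x.
assert (HK := geg_bound_ge1 lambda x).
assert (HK' : 0 < / geg_bound lambda x) by (apply Rinv_0_lt_compat; lra).
exists (mkposreal _ HK'). intros y Hy. apply geg_generating.
unfold ball in Hy; simpl in Hy.
unfold AbsRing_ball, abs, minus, plus, opp in Hy; simpl in Hy.
rewrite Ropp_0, Rplus_0_r in Hy. exact Hy.
Qed.

(* Main.v *)
From Pilot Require Import Defs.
From Stdlib Require Import Reals Arith Lra Lia.
From Coquelicot Require Import Coquelicot.
(* Restores [sigma] = 1 + x^2 over the partial sums called [sigma] in Rsigma. *)
Import Pilot.Defs.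
Open Scope R_scope.

(** By the Rodrigues formula with [l = nu], Q_N is w^(N) scaled by sigma^N / w,
where w = sigma^(-(a+1)) E and E = exp(- alpha arccot).  The factor E is the
weight for a = -1, so Leibniz' rule for the product gives ([Derive_n_mult])

  Q_N^(alpha,-a) = sum_nu binom(N,nu) nu! Q_(N-nu)^(alpha,1) T_nu(a+1),
  T_n(l) = sigma^(n+l) (sigma^(-l))^(n) / n!,

and what is left is to expand T_n(l) in Gegenbauer polynomials.

The reason for that expansion is visible on generating functions.  Since
1 + (x + sigma y)^2 = sigma (1 + 2xy + sigma y^2), Taylor's formula for
sigma^(-l) at x says that T_n(l) is the coefficient of y^n in
(1 + 2xy + sigma y^2)^(-l).  Writing sigma = 1 + x^2 and expanding
((1 + 2xy + y^2) + x^2 y^2)^(-l) by the binomial series in x^2 y^2 produces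
the powers (1 + 2xy + y^2)^(-(l+n)), that is, Gegenbauer polynomials of
parameter l + n at -x.

The proof replaces the double series by a recurrence.  The coefficients u l n
of (1 - ty + s y^2)^(-l) are determined by u l 0 = 1 and

  (n+1) u l (n+1) = l (t u (l+1) n - 2 s u (l+1) (n-1)),

which is the derivative in y ([lowering], [lowering_unique]).  It holds for
the Gegenbauer polynomials by differentiating their generating function
([gegenbauer_lowering]); it holds for T_n(l), with t = -2x and s = sigma, by
differentiating sigma^(-l) once and then n more times ([sigma_coef_lowering]);
and the binomial expansion turns a solution for s into a solution for s + r
([shift_sum_lowering]).  Taking r = x^2 and s = 1 identifies the two sides. *)

(** * The recurrence for coefficients of (1 - ty + s y^2)^(-l) *)

(** The index -1 carries the value 0, which lets one recurrence cover n = 0. *)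
Definition previous (u : nat -> R) (n : nat) : R :=
  match n with O => 0 | S m => u m end.

(** Satisfied by the coefficients in y of (1 - ty + s y^2)^(-l).  Unlike the
three-term recurrence at fixed [l], this one raises the parameter, and so it
is compatible with the binomial expansion in [shift_sum]. *)
Definition lowering (t s : R) (u : R -> nat -> R) : Prop :=
  (forall l, u l 0%nat = 1) /\
  (forall l n, INR (S n) * u l (S n) =
     l * (t * u (l + 1) n - 2 * s * previous (u (l + 1)) n)).

Lemma lowering_unique (t s : R) (u v : R -> nat -> R) :
  lowering t s u -> lowering t s v -> forall n l, u l n = v l n.
Proof.
intros [Hu0 Hu] [Hv0 Hv] n.
induction n as [n IH] using (well_founded_induction lt_wf). intros l.
destruct n as [|n]; [now rewrite Hu0, Hv0|].
apply (Rmult_eq_reg_l (INR (S n))); [|apply not_0_INR; lia].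
rewrite Hu, Hv, (IH n) by lia.
destruct n as [|n]; cbn [previous]; [reflexivity|].
rewrite (IH n) by lia. reflexivity.
Qed.

(** The k-th term of the expansion of the y^n coefficient of
((1 - ty + s y^2) + r y^2)^(-l) in powers of r y^2.  It is set to 0 where
the truncated subtraction [n - 2 * k] would be wrong, so that the sum over k
can be cut anywhere beyond [n / 2]. *)
Definition shift_term (r : R) (u : R -> nat -> R) (l : R) (n k : nat) : R :=
  if le_dec (2 * k) n then gbinom (- l) k * r ^ k * u (INR k + l) (n - 2 * k)%nat
  else 0.

Definition shift_sum (r : R) (u : R -> nat -> R) (l : R) (n : nat) : R :=
  sum_f_R0 (shift_term r u l n) (n / 2).

Lemma sum_f_R0_extend (f : nat -> R) (m n : nat) :
  (m <= n)%nat -> (forall k, (m < k)%nat -> f k = 0) ->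
  sum_f_R0 f n = sum_f_R0 f m.
Proof.
intros Hmn Hf. induction Hmn as [|n Hmn IH]; [reflexivity|].
simpl. rewrite IH, Hf by lia. ring.
Qed.

Lemma shift_term_out (r : R) (u : R -> nat -> R) (l : R) (n k : nat) :
  (n / 2 < k)%nat -> shift_term r u l n k = 0.
Proof.
intros H. unfold shift_term. destruct (le_dec (2 * k) n) as [Hk|]; [|reflexivity].
exfalso. assert (Hd := Nat.Div0.div_le_mono (2 * k) n 2 Hk).
rewrite Nat.mul_comm, Nat.div_mul in Hd; lia.
Qed.

Lemma shift_sum_extend (r : R) (u : R -> nat -> R) (l : R) (n m : nat) :
  (n <= m)%nat -> shift_sum r u l n = sum_f_R0 (shift_term r u l n) m.
Proof.
intros H. symmetry. apply sum_f_R0_extend.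
- apply Nat.le_trans with (2 := H). apply Nat.Div0.div_le_upper_bound; lia.
- intros k. apply shift_term_out.
Qed.

Lemma falling_S_l (c : R) (k : nat) : falling c (S k) = c * falling (c - 1) k.
Proof.
induction k as [|k IH]; [simpl; ring|].
change (falling c (S (S k))) with (falling c (S k) * (c - INR (S k))).
rewrite IH, S_INR. simpl. ring.
Qed.

(** Coefficient of z^k in (l + z d/dz) (1+z)^(-l) = l (1+z)^(-(l+1)): the factor
k + l that the recurrence at parameter l + k produces moves the binomial
coefficient from l to l + 1. *)
Lemma gbinom_absorb_l (l : R) (k : nat) :
  gbinom (- l) k * (INR k + l) = l * gbinom (- (l + 1)) k.
Proof.
unfold gbinom. assert (H : falling (- l) k * (INR k + l) = l * falling (- (l + 1)) k).
{ replace (- (l + 1)) with (- l - 1) by ring.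
  assert (E := falling_S_l (- l) k). simpl in E. lra. }
assert (H1 := INR_fact_neq_0 k).
apply (Rmult_eq_reg_r (INR (fact k))); [field_simplify; [lra|auto|auto]|auto].
Qed.

(** Coefficient of z^k in d/dz (1+z)^(-l) = - l (1+z)^(-(l+1)). *)
Lemma gbinom_absorb_S (l : R) (k : nat) :
  INR (S k) * gbinom (- l) (S k) = - l * gbinom (- (l + 1)) k.
Proof.
unfold gbinom. rewrite falling_S_l. replace (- (l + 1)) with (- l - 1) by ring.
rewrite fact_simpl, mult_INR. assert (H1 := INR_fact_neq_0 k).
field. split; [auto|]. apply not_0_INR; lia.
Qed.

(** The factor n + 1 splits as (n + 1 - 2k) + 2k.  The first part is the
recurrence for [u] at parameter l + k; the second lowers k by one through the
binomial coefficient and yields the contribution of r.  Summed over k, the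
two coefficients 2s and 2r combine into 2(s + r). *)
Lemma shift_term_lowering (t s r : R) (u : R -> nat -> R) :
  lowering t s u -> forall l n k,
  INR (S n) * shift_term r u l (S n) k =
  l * (t * shift_term r u (l + 1) n k
       - 2 * s * previous (fun m => shift_term r u (l + 1) m k) n
       - 2 * r * previous (fun j => previous (fun m => shift_term r u (l + 1) m j) n) k).
Proof.
intros [Hu0 Hu] l n k.
assert (D : INR (S n - 2 * k) * shift_term r u l (S n) k =
  l * (t * shift_term r u (l + 1) n k
       - 2 * s * previous (fun m => shift_term r u (l + 1) m k) n)).
{ assert (A := gbinom_absorb_l l k).
  unfold shift_term at 1. destruct (le_dec (2 * k) (S n)) as [H|H].
  - destruct (Nat.eq_dec (2 * k) (S n)) as [E|E].
    + replace (S n - 2 * k)%nat with 0%nat by lia. unfold shift_term.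
      destruct (le_dec (2 * k) n); [lia|].
      destruct n as [|n]; cbn [previous]; [simpl; ring|].
      destruct (le_dec (2 * k) n); [lia|]. simpl INR. ring.
    + replace (S n - 2 * k)%nat with (S (n - 2 * k)) by lia.
      transitivity (gbinom (- l) k * r ^ k *
        (INR (S (n - 2 * k)) * u (INR k + l) (S (n - 2 * k)))); [ring|].
      rewrite Hu.
      transitivity (gbinom (- l) k * (INR k + l) *
        (r ^ k * (t * u (INR k + l + 1) (n - 2 * k)%nat -
        2 * s * previous (u (INR k + l + 1)) (n - 2 * k)%nat))); [ring|].
      rewrite A.
      replace (INR k + l + 1) with (INR k + (l + 1)) by ring.
      unfold shift_term. destruct (le_dec (2 * k) n); [|lia].
      destruct n as [|n].
      * replace (0 - 2 * k)%nat with 0%nat by lia. cbn [previous]. simpl INR. ring.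
      * cbn [previous]. destruct (le_dec (2 * k) n).
        -- replace (S n - 2 * k)%nat with (S (n - 2 * k)) by lia. cbn [previous]. ring.
        -- replace (S n - 2 * k)%nat with 0%nat by lia. cbn [previous]. ring.
  - replace (S n - 2 * k)%nat with 0%nat by lia. unfold shift_term.
    destruct (le_dec (2 * k) n); [lia|].
    destruct n as [|n]; cbn [previous]; simpl INR; [ring|].
    destruct (le_dec _ n); [lia|]. ring. }
assert (B : INR (2 * k) * shift_term r u l (S n) k =
  l * (- 2 * r * previous (fun j => previous (fun m => shift_term r u (l + 1) m j) n) k)).
{ destruct k as [|k]; cbn [previous]; [simpl; ring|].
  unfold shift_term. destruct (le_dec (2 * S k) (S n)).
  - destruct n as [|n]; [lia|]. cbn [previous].
    destruct (le_dec (2 * k) n); [|lia].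
    replace (S (S n) - 2 * S k)%nat with (n - 2 * k)%nat by lia.
    replace (INR (S k) + l) with (INR k + (l + 1)) by (rewrite S_INR; ring).
    assert (A := gbinom_absorb_S l k).
    rewrite mult_INR. change (r ^ S k) with (r * r ^ k). change (INR 2) with 2.
    transitivity (2 * (INR (S k) * gbinom (- l) (S k)) * (r * r ^ k) *
      u (INR k + (l + 1)) (n - 2 * k)%nat); [ring|].
    rewrite A. ring.
  - destruct n as [|n]; cbn [previous]; [simpl; ring|].
    destruct (le_dec (2 * k) n); [lia|]. ring. }
(* For [2 * k > S n] truncation breaks the splitting, but then the term is 0. *)
destruct (le_dec (2 * k) (S n)).
- replace (INR (S n)) with (INR (S n - 2 * k) + INR (2 * k))
    by (rewrite <- plus_INR; f_equal; lia).
  lra.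
- assert (Z : shift_term r u l (S n) k = 0)
    by (unfold shift_term; destruct (le_dec (2 * k) (S n)); [lia|reflexivity]).
  rewrite Z in *. lra.
Qed.

Lemma sum_previous (f : nat -> R) (n : nat) :
  sum_f_R0 (previous f) (S n) = sum_f_R0 f n.
Proof.
rewrite decomp_sum by lia. apply Rplus_0_l.
Qed.

Lemma shift_sum_lowering (t s r : R) (u : R -> nat -> R) :
  lowering t s u -> lowering t (s + r) (shift_sum r u).
Proof.
intros Hu. split.
- intros l. unfold shift_sum, shift_term. simpl.
  rewrite (proj1 Hu). unfold gbinom; simpl. field.
- intros l n.
  rewrite (shift_sum_extend r u l (S n) (S n)) by lia.
  rewrite scal_sum.
  rewrite (sum_eq _ (fun k =>
    shift_term r u (l + 1) n k * (l * t)
    + (previous (fun m => shift_term r u (l + 1) m k) n * (- 2 * l * s)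
       + previous (fun j => previous (fun m => shift_term r u (l + 1) m j) n) k
         * (- 2 * l * r)))).
  2:{ intros k _. rewrite Rmult_comm, (shift_term_lowering t s r u Hu). ring. }
  rewrite !plus_sum, <- !scal_sum.
  rewrite (sum_previous (fun j => previous (fun m => shift_term r u (l + 1) m j) n)).
  rewrite <- shift_sum_extend by lia.
  destruct n as [|n]; cbn [previous].
  + rewrite !sum_eq_R0 by reflexivity. ring.
  + rewrite <- !(shift_sum_extend r u (l + 1) n) by lia. ring.
Qed.

(** * Gegenbauer polynomials *)

Lemma ex_pseries_CV_radius_pos (a : nat -> R) :
  locally 0 (fun y : R => ex_pseries a y) -> Rbar_lt 0 (CV_radius a).
Proof.
intros [eps H].
assert (He := cond_pos eps).
assert (Hy : ex_pseries a (eps / 2)).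
{ apply H. unfold ball; simpl. unfold AbsRing_ball, abs, minus, plus, opp; simpl.
  rewrite Rabs_right; lra. }
apply Rbar_lt_le_trans with (Rabs (eps / 2)).
{ simpl. rewrite Rabs_right; lra. }
apply Rbar_not_lt_le. intros Hlt.
apply (CV_disk_outside _ _ Hlt).
apply ex_series_lim_0. destruct Hy as [v Hv]. exists v.
apply is_pseries_R in Hv. exact Hv.
Qed.

Lemma is_pseries_unique_coef (a b : nat -> R) (F : R -> R) :
  locally 0 (fun y : R => is_pseries a y (F y)) ->
  locally 0 (fun y : R => is_pseries b y (F y)) ->
  forall n, a n = b n.
Proof.
intros Ha Hb n. apply PSeries_ext_recip.
- apply ex_pseries_CV_radius_pos. revert Ha. apply filter_imp. intros y Hy.
  exists (F y). exact Hy.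
- apply ex_pseries_CV_radius_pos. revert Hb. apply filter_imp. intros y Hy.
  exists (F y). exact Hy.
- generalize (filter_and _ _ Ha Hb). apply filter_imp. intros y [H1 H2].
  rewrite (is_pseries_unique _ _ _ H1), (is_pseries_unique _ _ _ H2). reflexivity.
Qed.

Lemma is_pseries_PS_derive (a : nat -> R) (F F' : R -> R) :
  locally 0 (fun y : R => is_pseries a y (F y)) ->
  locally 0 (fun y : R => is_derive F y (F' y)) ->
  locally 0 (fun y : R => is_pseries (PS_derive a) y (F' y)).
Proof.
intros Ha HF.
assert (HR : Rbar_lt 0 (CV_radius a)).
{ apply ex_pseries_CV_radius_pos. revert Ha. apply filter_imp. intros y Hy.
  exists (F y). exact Hy. }
assert (Hin : locally 0 (fun y : R => Rbar_lt (Rabs y) (CV_radius a))).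
{ destruct (CV_radius a) as [r| |]; simpl in HR |- *; try easy.
  - exists (mkposreal r HR). intros y Hy.
    unfold ball in Hy; simpl in Hy.
    unfold AbsRing_ball, abs, minus, plus, opp in Hy; simpl in Hy.
    rewrite Ropp_0, Rplus_0_r in Hy. exact Hy.
  - apply filter_true. }
apply locally_locally in Ha.
generalize (filter_and _ _ Ha (filter_and _ _ HF Hin)).
apply filter_imp. intros y [H1 [H2 H3]].
rewrite <- (is_derive_unique _ _ _ H2).
rewrite <- (Derive_ext_loc (PSeries a)).
- apply is_pseries_derive, H3.
- revert H1. apply filter_imp. intros z Hz. apply is_pseries_unique, Hz.
Qed.

Lemma gegenbauer_base_pos (x : R) :
  locally 0 (fun y : R => 0 < 1 - 2 * x * y + y ^ 2).
Proof.
assert (H : continuous (fun y : R => 1 - 2 * x * y + y ^ 2) 0).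
{ apply (ex_derive_continuous (fun y : R => 1 - 2 * x * y + y ^ 2)). auto_derive. exact I. }
apply H. apply (open_gt 0). simpl. lra.
Qed.

(** The generating function F_l = (1 - 2xy + y^2)^(-l) has
dF_l/dy = 2 l (x - y) F_(l+1); compare coefficients of y^n. *)
Lemma gegenbauer_lowering (C : R -> nat -> R -> R) (x : R) :
  is_gegenbauer C -> lowering (2 * x) 1 (fun l n => C l n x).
Proof.
intros HC. split.
- intros l. destruct (HC l x) as [eps H].
  assert (H0 := H 0 (ball_center 0 eps)). apply is_pseries_unique in H0.
  rewrite PSeries_0 in H0. rewrite H0. unfold Rpower.
  replace (1 - 2 * x * 0 + 0 ^ 2) with 1 by ring. now rewrite ln_1, Rmult_0_r, exp_0.
- intros l n.
  set (b := fun y : R => 1 - 2 * x * y + y ^ 2).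
  assert (HD : locally 0 (fun y : R => is_derive (fun y => Rpower (b y) (- l)) y
    (2 * l * (x - y) * Rpower (b y) (- (l + 1))))).
  { generalize (gegenbauer_base_pos x). apply filter_imp. intros y Hy.
    replace (Rpower (b y) (- (l + 1))) with (Rpower (b y) (- l) * / b y).
    2:{ rewrite <- (Rpower_1 (b y)) at 2 by exact Hy.
        rewrite <- Rpower_Ropp, <- Rpower_plus. f_equal. ring. }
    unfold Rpower, b. auto_derive; [exact Hy|].
    replace (1 + - (2 * x * y) + y * (y * 1)) with (1 - 2 * x * y + y ^ 2) by ring.
    field. lra. }
  assert (H1 := is_pseries_PS_derive _ _ _ (HC l x) HD).
  assert (H2 : locally 0 (fun y : R => is_pseries
    (PS_plus (PS_scal (2 * l * x) (fun k => C (l + 1) k x))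
       (PS_scal (- (2 * l)) (PS_incr_1 (fun k => C (l + 1) k x)))) y
    (2 * l * (x - y) * Rpower (b y) (- (l + 1))))).
  { generalize (HC (l + 1) x). apply filter_imp. intros y Hy. fold (b y) in Hy.
    evar_last.
    - apply (is_pseries_plus (K := R_AbsRing) (V := R_NormedModule));
        apply (is_pseries_scal (K := R_AbsRing) (V := R_NormedModule));
        [apply Rmult_comm|exact Hy|apply Rmult_comm|].
      apply (is_pseries_incr_1 (K := R_AbsRing) (V := R_NormedModule)), Hy.
    - unfold plus, scal; simpl; unfold mult; simpl; ring. }
  assert (E := is_pseries_unique_coef _ _ _ H1 H2 n).
  unfold PS_derive, PS_plus, PS_scal, plus, scal in E; simpl in E.
  unfold mult in E; simpl in E.
  change (INR (S n)) with (match n with 0%nat => 1 | S _ => INR n + 1 end).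
  rewrite E. destruct n as [|n]; simpl; unfold zero; simpl; ring.
Qed.

(** * Leibniz' rule *)

(** All orders up to [N] are required because [ex_derive_n f k] concerns the
k-th derivative only; the bound [N] makes induction possible when the
derivative of a function involves other functions of the same family. *)
Definition smooth_upto (N : nat) (f : R -> R) : Prop :=
  forall k x, (k <= N)%nat -> ex_derive_n f k x.

Lemma smooth_upto_ext (N : nat) (f g : R -> R) :
  (forall x, f x = g x) -> smooth_upto N f -> smooth_upto N g.
Proof.
intros E H k x Hk. apply (ex_derive_n_ext f); auto.
Qed.

Lemma smooth_upto_Derive (N : nat) (f : R -> R) :
  (forall x, ex_derive f x) -> smooth_upto N (Derive f) -> smooth_upto (S N) f.
Proof.
intros H0 H [|[|k]] x Hk; [exact I|apply H0|].
apply (ex_derive_ext (Derive_n (Derive f) k)).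
- intros t. change (Derive_n (Derive_n f 1) k t = Derive_n f (S k) t).
  rewrite Derive_n_comp. f_equal. lia.
- apply (H (S k)). lia.
Qed.

Lemma smooth_upto_affine (N : nat) (a b : R) : smooth_upto N (fun x => a * x + b).
Proof.
destruct N as [|N].
- intros k x Hk. replace k with 0%nat by lia. exact I.
- apply smooth_upto_Derive; [intros x; auto_derive; exact I|].
  apply (smooth_upto_ext N (fun _ => a)).
  + intros x. symmetry. apply is_derive_unique. auto_derive; [exact I|ring].
  + intros k x _. apply ex_derive_n_const.
Qed.

Definition leibniz_sum (f g : R -> R) (n : nat) (x : R) : R :=
  sum_f_R0 (fun k => Binomial.C n k * (Derive_n f k x * Derive_n g (n - k) x)) n.

Lemma is_derive_sum_f_R0 (f : nat -> R -> R) (d : nat -> R) (n : nat) (x : R) :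
  (forall k, (k <= n)%nat -> is_derive (f k) x (d k)) ->
  is_derive (fun y => sum_f_R0 (fun k => f k y) n) x (sum_f_R0 d n).
Proof.
intros H. rewrite <- sum_n_Reals.
apply (is_derive_ext (fun y => sum_n (fun k => f k y) n)).
- intros t. apply sum_n_Reals.
- apply (is_derive_sum_n f n x d H).
Qed.

(** Pascal's rule in the form in which Leibniz' rule passes from order n to
order n + 1: for A k = f^(k) g^(n+1-k), differentiating the k-th term of order n
yields A (k+1) + A k. *)
Lemma sum_pascal (A : nat -> R) (n : nat) :
  sum_f_R0 (fun k => Binomial.C n k * (A (S k) + A k)) n =
  sum_f_R0 (fun k => Binomial.C (S n) k * A k) (S n).
Proof.
rewrite tech5, C_n_n. destruct n as [|n].
{ simpl. rewrite !C_n_0. ring. }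
rewrite (sum_eq _ (fun k => Binomial.C (S n) k * A (S k) + Binomial.C (S n) k * A k))
  by (intros; ring).
rewrite plus_sum, (tech5 (fun k => Binomial.C (S n) k * A (S k))), C_n_n.
rewrite (decomp_sum (fun k => Binomial.C (S n) k * A k)) by lia.
rewrite (decomp_sum (fun k => Binomial.C (S (S n)) k * A k)) by lia.
simpl Nat.pred. rewrite !C_n_0.
rewrite (sum_eq (fun i => Binomial.C (S (S n)) (S i) * A (S i))
  (fun i => Binomial.C (S n) i * A (S i) + Binomial.C (S n) (S i) * A (S i))).
- rewrite plus_sum. ring.
- intros i Hi. rewrite <- pascal by lia. ring.
Qed.

Lemma is_derive_leibniz_sum (f g : R -> R) (n : nat) (x : R) :
  smooth_upto (S n) f -> smooth_upto (S n) g ->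
  is_derive (leibniz_sum f g n) x (leibniz_sum f g (S n) x).
Proof.
intros Hf Hg. unfold leibniz_sum at 2.
rewrite <- (sum_pascal (fun k => Derive_n f k x * Derive_n g (S n - k) x)).
apply is_derive_sum_f_R0. intros k Hk.
evar_last.
- apply is_derive_scal, (is_derive_mult (Derive_n f k) (Derive_n g (n - k))).
  + apply Derive_correct, (Hf (S k)). lia.
  + apply Derive_correct, (Hg (S (n - k))). lia.
  + exact Rmult_comm.
- replace (S n - S k)%nat with (n - k)%nat by lia.
  replace (S n - k)%nat with (S (n - k)) by lia.
  reflexivity.
Qed.

Lemma Derive_n_mult (f g : R -> R) (N : nat) :
  smooth_upto N f -> smooth_upto N g ->
  forall n x, (n <= N)%nat ->
  Derive_n (fun t => f t * g t) n x = leibniz_sum f g n x.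
Proof.
intros Hf Hg n. induction n as [|n IH]; intros x Hn.
- unfold leibniz_sum. simpl. rewrite C_n_0. ring.
- simpl. rewrite (Derive_ext _ (leibniz_sum f g n)) by (intros t; apply IH; lia).
  apply is_derive_unique, is_derive_leibniz_sum;
    intros k y Hk; [apply Hf | apply Hg]; lia.
Qed.

(** The Leibniz sum is itself differentiable, which gives existence of the next
derivative of the product. *)
Lemma smooth_upto_mult (f g : R -> R) (N : nat) :
  smooth_upto N f -> smooth_upto N g -> smooth_upto N (fun t => f t * g t).
Proof.
intros Hf Hg [|n] x Hn; [exact I|].
apply (ex_derive_ext (leibniz_sum f g n)).
- intros t. symmetry. apply (Derive_n_mult f g N Hf Hg). lia.
- eexists. apply is_derive_leibniz_sum;
    intros k y Hk; [apply Hf | apply Hg]; lia.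
Qed.

(** * Derivatives of the weights *)

(** One family that contains the weight, its factor sigma^(-l) (for
[alpha = 0]) and its factor exp(- alpha arccot) (for [c = 0]). *)
Definition pearson (c alpha x : R) : R :=
  Rpower (sigma x) c * exp (- alpha * arccot x).

Lemma is_derive_pearson (c alpha x : R) :
  is_derive (pearson c alpha) x ((2 * c * x + alpha) * pearson (c - 1) alpha x).
Proof.
assert (Hs := sigma_pos x).
assert (E : Rpower (sigma x) (c - 1) = Rpower (sigma x) c * / sigma x).
{ rewrite <- (Rpower_1 (sigma x)) at 3 by exact Hs.
  now rewrite <- Rpower_Ropp, <- Rpower_plus. }
unfold pearson. rewrite E. unfold Rpower, arccot.
unfold sigma in *. auto_derive; [simpl in Hs; lra|].
unfold Rsqr, Rdiv. replace (1 + x * (x * 1)) with (1 + x ^ 2) by ring.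
replace (1 + x * x) with (1 + x ^ 2) by ring.
unfold Rminus. field. lra.
Qed.

(** Differentiation only multiplies by an affine function and lowers [c], so
the induction on the order runs over all exponents at once. *)
Lemma pearson_smooth (alpha : R) (N : nat) :
  forall c, smooth_upto N (pearson c alpha).
Proof.
induction N as [|N IH]; intros c.
- intros k x Hk. replace k with 0%nat by lia. exact I.
- apply smooth_upto_Derive.
  + intros x. eexists. apply is_derive_pearson.
  + apply (smooth_upto_ext N (fun x => (2 * c * x + alpha) * pearson (c - 1) alpha x)).
    * intros x. symmetry. apply is_derive_unique, is_derive_pearson.
    * apply smooth_upto_mult; [apply smooth_upto_affine|apply IH].
Qed.

Lemma Derive_n_id_mult (f : R -> R) (N : nat) :
  smooth_upto N f -> forall n x, (n <= N)%nat ->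
  Derive_n (fun t => t * f t) n x =
  x * Derive_n f n x + INR n * Derive_n f (pred n) x.
Proof.
intros Hf n. induction n as [|n IH]; intros x Hn; [simpl; ring|].
change (Derive (Derive_n (fun t => t * f t) n) x =
  x * Derive_n f (S n) x + INR (S n) * Derive_n f n x).
rewrite (Derive_ext _ (fun t => t * Derive_n f n t + INR n * Derive_n f (pred n) t))
  by (intros t; apply IH; lia).
apply is_derive_unique.
assert (H1 : is_derive (Derive_n f n) x (Derive_n f (S n) x))
  by (apply Derive_correct, (Hf (S n)); lia).
assert (H2 : is_derive (fun t => INR n * Derive_n f (pred n) t) x
  (INR n * Derive_n f n x)).
{ destruct n as [|n].
  - simpl. apply (is_derive_ext (fun _ => 0)); [intros; symmetry; apply Rmult_0_l|].
    rewrite Rmult_0_l. apply is_derive_Reals, derivable_pt_lim_const.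
  - apply is_derive_scal, Derive_correct, (Hf (S n)). lia. }
evar_last.
- apply (is_derive_plus (fun t => t * Derive_n f n t)); [|exact H2].
  apply (is_derive_mult (fun t : R => t) (Derive_n f n)); [apply is_derive_id|exact H1|].
  exact Rmult_comm.
- rewrite S_INR. unfold plus, mult, one; simpl. ring.
Qed.

(** The quantity T_n(l): the coefficient of y^n in (1 + 2xy + sigma y^2)^(-l),
obtained from Taylor's formula for sigma^(-l) at x with increment sigma y. *)
Definition sigma_coef (x l : R) (n : nat) : R :=
  Rpower (sigma x) (INR n + l) * Derive_n (pearson (- l) 0) n x / INR (fact n).

(** Differentiate (sigma^(-l))' = - 2 l x sigma^(-(l+1)) another n times; only
two terms of Leibniz' rule survive for the factor x. *)
Lemma sigma_coef_lowering (x : R) : lowering (- 2 * x) (sigma x) (sigma_coef x).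
Proof.
split.
- intros l. unfold sigma_coef, pearson. simpl.
  rewrite Ropp_0, Rmult_0_l, exp_0, Rmult_1_r, <- Rpower_plus.
  replace (0 + l + - l) with 0 by ring. rewrite Rpower_O by apply sigma_pos. field.
- intros l n. unfold sigma_coef at 1.
  assert (E : Derive_n (pearson (- l) 0) (S n) x =
    - (2 * l) * (x * Derive_n (pearson (- (l + 1)) 0) n x
               + INR n * Derive_n (pearson (- (l + 1)) 0) (pred n) x)).
  { rewrite <- (Derive_n_id_mult _ n (pearson_smooth 0 n _)) by lia.
    rewrite <- Derive_n_scal_l.
    replace (S n) with (n + 1)%nat by lia. rewrite <- Derive_n_comp.
    apply Derive_n_ext. intros t. apply is_derive_unique.
    replace (- (l + 1)) with (- l - 1) by ring.
    evar_last; [apply is_derive_pearson|]. ring. }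
  rewrite E. clear E.
  rewrite fact_simpl, mult_INR.
  assert (H1 := INR_fact_neq_0 n). assert (H2 : INR (S n) <> 0) by (apply not_0_INR; lia).
  replace (INR (S n) + l) with (INR n + (l + 1)) by (rewrite S_INR; ring).
  destruct n as [|n]; unfold sigma_coef at 1; cbn [previous].
  + simpl. field.
  + unfold sigma_coef at 1.
    replace (INR (S n) + (l + 1)) with (1 + (INR n + (l + 1))) by (rewrite S_INR; ring).
    rewrite (Rpower_plus 1), (Rpower_1 _ (sigma_pos x)). simpl Nat.pred.
    rewrite fact_simpl, mult_INR in *.
    assert (INR (fact n) <> 0) by apply INR_fact_neq_0.
    assert (INR (S n) <> 0) by (apply not_0_INR; lia).
    field. auto.
Qed.

(** Here sigma = 1 + x^2 is the shift of s = 1 by r = x^2, and -2x = 2(-x) is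
the value of t for Gegenbauer polynomials at -x. *)
Lemma sigma_coef_gegenbauer (C : R -> nat -> R -> R) (x l : R) (n : nat) :
  is_gegenbauer C ->
  sigma_coef x l n =
  sum_f_R0 (fun k => gbinom (- l) k * x ^ (2 * k) * C (INR k + l) (n - 2 * k)%nat (- x))
    (n / 2).
Proof.
intros HC.
assert (HG := shift_sum_lowering _ _ (x ^ 2) _ (gegenbauer_lowering C (- x) HC)).
rewrite (lowering_unique (- 2 * x) (sigma x) (sigma_coef x)
  (shift_sum (x ^ 2) (fun l n => C l n (- x)))).
- apply sum_eq. intros k Hk. unfold shift_term.
  rewrite pow_mult. destruct (le_dec (2 * k) n) as [|H]; [reflexivity|].
  assert (Hm := Nat.Div0.mul_div_le n 2). lia.
- apply sigma_coef_lowering.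
- unfold sigma. replace (- 2 * x) with (2 * - x) by ring. exact HG.
Qed.

(** * The expansion of the complementary polynomials *)

Lemma complementary_romanovski (Q : R -> R -> nat -> R -> R) (alpha a : R) (N : nat) (x : R) :
  is_complementary Q ->
  Q alpha (- a) N x =
  Rpower (sigma x) (INR N + (a + 1)) * exp (alpha * arccot x)
  * Derive_n (pearson (- (a + 1)) alpha) N x.
Proof.
intros HQ. destruct (HQ alpha a) as [_ H].
assert (E := H N N x (le_n N)). rewrite Nat.sub_diag in E. simpl in E.
assert (Hw := weight_pos a alpha N x).
replace (Q alpha (- a) N x) with (romanovski a alpha N x)
  by (rewrite E; field; lra).
unfold romanovski. rewrite (Derive_n_ext _ (pearson (- (a + 1)) alpha)).
- f_equal. unfold weight. rewrite Rinv_mult, <- Rpower_Ropp, <- exp_Ropp.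
  f_equal; f_equal; ring.
- intros t. rewrite weight_sigma. unfold weight, pearson. simpl. f_equal. f_equal. ring.
Qed.

Theorem theorem4p3 :
  forall (Q : R -> R -> nat -> R -> R) (C : R -> nat -> R -> R),
    is_complementary Q ->
    is_gegenbauer C ->
    forall (alpha a : R) (N : nat) (x : R),
      Q alpha (- a) N x =
      sum_f_R0 (fun nu : nat =>
        Binomial.C N nu * INR (fact nu) * Q alpha 1 (N - nu)%nat x *
        sum_f_R0 (fun n : nat =>
          gbinom (- a - 1) n * x ^ (2 * n) *
          C (INR n + a + 1) (nu - 2 * n)%nat (- x)) (nu / 2)%nat) N.
Proof.
intros Q C HQ HC alpha a N x.
rewrite (complementary_romanovski Q alpha a N x HQ).
(* The weight is sigma^(-(a+1)) times the weight for a = -1. *)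
rewrite (Derive_n_ext _ (fun t => pearson (- (a + 1)) 0 t * pearson 0 alpha t)).
2:{ intros t. unfold pearson.
    rewrite Ropp_0, Rmult_0_l, exp_0, Rpower_O by apply sigma_pos. ring. }
rewrite (Derive_n_mult _ _ N) by (try apply pearson_smooth; lia).
unfold leibniz_sum. rewrite scal_sum. apply sum_eq. intros nu Hnu.
replace (Q alpha 1) with (Q alpha (- (-1))) by (f_equal; ring).
rewrite (complementary_romanovski Q alpha (-1) (N - nu) x HQ).
replace (- (-1 + 1)) with 0 by ring.
rewrite (sum_eq _ (fun k => gbinom (- (a + 1)) k * x ^ (2 * k) *
  C (INR k + (a + 1)) (nu - 2 * k)%nat (- x))).
2:{ intros k _. replace (- (a + 1)) with (- a - 1) by ring.
    now rewrite Rplus_assoc. }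
rewrite <- (sigma_coef_gegenbauer C x (a + 1) nu HC). unfold sigma_coef.
replace (INR N + (a + 1)) with ((INR (N - nu) + (-1 + 1)) + (INR nu + (a + 1)))
  by (rewrite minus_INR by lia; ring).
rewrite Rpower_plus. field. apply INR_fact_neq_0.
Qed.
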